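(* Let $1<p<\infty$ and let $\|x\|_p=\big(\sum_{i=1}^n|x_i|^p\big)^{1/p}$ on $\mathbb{R}^n$. Then $\|\cdot\|_p$ is geometrically convex in the tangent plane, doubling in the tangent plane, and balanced in the tangent plane.
   Context: For a norm $\|\cdot\|$ differentiable on $\mathbb{R}^n\setminus\{0\}$, $N(x)$ denotes its gradient at $x\ne0$, $\langle\cdot,\cdot\rangle$ the Euclidean inner product, and $h(x,y)=\|y\|-\langle y,N(x)\rangle$. The norm is: - geometrically convex in the tangent plane if there are $\Lambda>2$, $r>0$ with $h(x,x+2y)\ge\Lambda h(x,x+y)$ whenever $x\ne0$, $\|y\|\le r\|x\|$, $\langle y,N(x)\rangle=0$; - doubling in the tangent plane if there are $T,r>0$ with $h(x,x+2y)\le Th(x,x+y)$ whenever $x\ne0$, $\|y\|\le r\|x\|$, $\langle y,N(x)\rangle=0$; - balanced in the tangent plane if there are $r,K>0$ with $h(x,x+y)\le Kh(x,x-y)$ whenever $x\ne0$, $\|y\|\le r\|x\|$, $\langle y,N(x)\rangle=0$. *)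

(* Defs.v *)
From HB Require Import structures.
From mathcomp Require Import all_boot all_order all_algebra.
From mathcomp Require Import all_classical all_reals all_analysis.
Set Implicit Arguments. Unset Strict Implicit. Unset Printing Implicit Defensive.
Import Order.TTheory GRing.Theory Num.Theory.
Import numFieldNormedType.Exports.
Local Open Scope ring_scope.

Section Defs.
Variables (R : realType) (n : nat).

Definition pnorm (p : R) (x : 'rV[R]_n) : R :=
  (\sum_(i < n) `|x ord0 i| `^ p) `^ p^-1.

Definition inner (x y : 'rV[R]_n) : R := \sum_(i < n) x ord0 i * y ord0 i.

Definition grad (f : 'rV[R]_n -> R) (x : 'rV[R]_n) : 'rV[R]_n :=
  \row_(i < n) 'D_(delta_mx ord0 i) f x.

Definition hfun (f : 'rV[R]_n -> R) (x y : 'rV[R]_n) : R :=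
  f y - inner y (grad f x).

Definition geom_convex_tangent (f : 'rV[R]_n -> R) : Prop :=
  exists (Lam r : R), 2 < Lam /\ 0 < r /\
    forall x y : 'rV[R]_n, x != 0 -> f y <= r * f x -> inner y (grad f x) = 0 ->
      Lam * hfun f x (x + y) <= hfun f x (x + 2 *: y).

Definition doubling_tangent (f : 'rV[R]_n -> R) : Prop :=
  exists (T r : R), 0 < T /\ 0 < r /\
    forall x y : 'rV[R]_n, x != 0 -> f y <= r * f x -> inner y (grad f x) = 0 ->
      hfun f x (x + 2 *: y) <= T * hfun f x (x + y).

Definition balanced_tangent (f : 'rV[R]_n -> R) : Prop :=
  exists (r K : R), 0 < r /\ 0 < K /\
    forall x y : 'rV[R]_n, x != 0 -> f y <= r * f x -> inner y (grad f x) = 0 ->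
      hfun f x (x + y) <= K * hfun f x (x - y).

End Defs.

(* Main.v *)
Require Import Defs.
From HB Require Import structures.
From mathcomp Require Import all_boot all_order all_algebra.
From mathcomp Require Import all_classical all_reals all_analysis.
From mathcomp Require Import ring lra.
Set Implicit Arguments. Unset Strict Implicit. Unset Printing Implicit Defensive.
Import Order.TTheory GRing.Theory Num.Theory.
Import numFieldNormedType.Exports.
Local Open Scope ring_scope.

(** Write [g x = sg x * |x|^(p-1)] and let
    [phi a b = |a + b|^p - |a|^p - p * g a * b >= 0] be the Bregman divergence of
    [|.|^p].  The gradient of the norm at [x] is a positive multiple of
    [(g x_i)_i], so for [y] in the tangent plane
    [|x + y|_p^p - |x|_p^p = \sum_i phi x_i y_i] and [h(x, x + y) = |x + y|_p - |x|_p].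

    Tangent lines bound [phi a b] above by [p * b * (g (a + b) - g a)], and
    [phi a b - 2 * phi a (b / 2)] below by an increment of [g] over a subinterval
    of the segment.  Since [(y - x) * (g y - g x)] is comparable to
    [(y - x)^2 * max(|x|, |y|)^(p - 2)], one gets
    [phi a b <= C * (phi a (t * b) - 2 * phi a (t * b / 2))] for [1/2 <= |t| <= 2].
    The choices [t = 2], [1/2] and [-1] are the three claims for [phi], the first
    with ratio [2 + 1/C > 2].  They pass to the norm because [s |-> s^(1/p)] is
    nearly affine close to [|x|_p^p], at the price of a factor [M] that is as close
    to [1] as wished when [r] is small. *)

(** * Inequalities for powers of real numbers *)

Section RealPowers.
Context {R : realType}.
Implicit Types (a b p q x y z : R).

(** Young's inequality for the conjugate exponents [p] and [p / (p - 1)], at [x] and [y^(p-1)].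
    Rearranged, it puts [s^p] above its tangent line at [y]. *)
Lemma young_powR p x y : 1 < p -> 0 <= x -> 0 <= y ->
  p * (x * y `^ (p - 1)) <= x `^ p + (p - 1) * y `^ p.
Proof.
move=> p1 x0 y0; have p0 : 0 < p by lra.
have q0 : 0 < p / (p - 1) by rewrite divr_gt0// subr_gt0.
have := @conjugate_powR R x (y `^ (p - 1)) p (p / (p - 1)) x0 (powR_ge0 _ _) p0 q0.
have -> : p^-1 + (p / (p - 1))^-1 = 1 by field; lra.
have -> : (y `^ (p - 1)) `^ (p / (p - 1)) = y `^ p.
  by rewrite -powRrM; congr (_ `^ _); field; lra.
move=> /(_ erefl) H.
have -> : x `^ p + (p - 1) * y `^ p = p * (x `^ p / p + y `^ p / (p / (p - 1))).
  by field; lra.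
by rewrite ler_pM2l.
Qed.

(** One bound is the tangent line at [y], the other compares [x^(q-1)] with [y^(q-1)]. They exchange
    roles at [q = 1], where [s^q] passes from concave to convex, hence the [min] and [max]. *)
Lemma powR_increment_bounds q x y : 0 < q -> 0 <= x -> x <= y ->
  Num.min 1 q * ((y - x) * y `^ (q - 1)) <= y `^ q - x `^ q /\
  y `^ q - x `^ q <= Num.max 1 q * ((y - x) * y `^ (q - 1)).
Proof.
move=> q0 x0 xy; have y0 : 0 <= y by lra.
have [->|yN0] := eqVneq y x; first by rewrite !subrr !mul0r !mulr0.
have {yN0}xy' : x < y by rewrite lt_neqAle eq_sym yN0.
have yp : 0 < y by lra.
have Ey : y `^ q = y * y `^ (q - 1) by rewrite mulr_powRB1.
have Ex : x `^ q = x * x `^ (q - 1) by rewrite mulr_powRB1.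
have Y0 := powR_ge0 y (q - 1).
have [q1|q1|q1] := ltgtP 1 q.
- have := young_powR q1 x0 y0.
  have : x `^ (q - 1) <= y `^ (q - 1).
    by rewrite ge0_ler_powR// ?nnegrE//; lra.
  by move=> *; split; nra.
- have xq : x * y `^ (q - 1) <= x `^ q.
    move: x0; rewrite le_eqVlt => /predU1P[<-|xp].
      by rewrite mul0r powR_ge0.
    rewrite Ex ler_pM2l//.
    have -> : q - 1 = - (1 - q) by ring.
    rewrite !powRN lef_pV2 ?posrE ?powR_gt0//.
    by rewrite ge0_ler_powR// ?nnegrE//; lra.
  (* Concavity of [s^q]: Young's inequality with exponent [1/q > 1] at [x^q] and [y^q]. *)
  have : x `^ q <= q * x * y `^ (q - 1) + (1 - q) * y `^ q.
    have q1' : 1 < q^-1 by rewrite invf_gt1.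
    have := @young_powR q^-1 (x `^ q) (y `^ q) q1' (powR_ge0 _ _) (powR_ge0 _ _).
    rewrite -!powRrM mulfV ?gt_eqF// !powRr1//.
    have -> : q * (q^-1 - 1) = 1 - q by field; lra.
    have -> : y `^ (1 - q) = (y `^ (q - 1))^-1 by rewrite -powRN opprB.
    have Yp : 0 < y `^ (q - 1) by rewrite powR_gt0.
    rewrite -(ler_pM2r (mulr_gt0 q0 Yp)).
    set A := x `^ q. set B := y `^ (q - 1).
    have -> : q^-1 * (A * B^-1) * (q * B) = A by field; rewrite /B; lra.
    have -> : (x + (q^-1 - 1) * y) * (q * B) = q * x * B + (1 - q) * (y * B).
      by field; lra.
    by rewrite Ey.
  by move=> *; split; nra.
- by rewrite -q1 subrr powRr0 !powRr1//; split; lra.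
Qed.


(** The odd extension of [s^q] to the line; [spowR (p - 1)] is the function [g] above. *)
Definition spowR q x : R := Num.sg x * `|x| `^ q.

Lemma ge0_spowR q x : 0 < q -> 0 <= x -> spowR q x = x `^ q.
Proof.
rewrite /spowR le_eqVlt => q0 /predU1P[<-|x0].
  by rewrite normr0 powR0 ?mulr0// gt_eqF.
by rewrite gtr0_sg// mul1r gtr0_norm.
Qed.

Lemma spowRN q x : spowR q (- x) = - spowR q x.
Proof. by rewrite /spowR sgrN normrN mulNr. Qed.

Lemma mulr_spowRB1 p x : 0 < p -> x * spowR (p - 1) x = `|x| `^ p.
Proof. by move=> p0; rewrite /spowR mulrA [x * _]mulrC -normrEsg mulr_powRB1. Qed.

(** Swapping [x] and [y] or negating both reduces to [x <= y] and [|x| <= |y|], so that the maximum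
    is [y]. For [x < 0], [y - x] lies between [y] and [2y], and the increment of [spowR q] between
    [y^q] and [2y^q]; the halved and the enlarged constants make room for this case. *)
Lemma spowR_increment_bounds q x y : 0 < q ->
  let m := Num.max `|x| `|y| in
  Num.min 1 q / 2 * ((y - x) ^+ 2 * m `^ (q - 1))
    <= (y - x) * (spowR q y - spowR q x) /\
  (y - x) * (spowR q y - spowR q x)
    <= (1 + Num.max 1 q) * ((y - x) ^+ 2 * m `^ (q - 1)).
Proof.
move=> q0 /=.
wlog xy : x y / x <= y.
  move=> H; have /orP[/H//|/H] := le_total x y.
  by rewrite maxC -(opprB y x) -(opprB (spowR q y)) sqrrN mulrNN.
wlog nxy : x y xy / `|x| <= `|y|.
  move=> H; have /orP[/(H _ _ xy)//|nyx] := le_total `|x| `|y|.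
  have := H (- y) (- x); rewrite !normrN !spowRN maxC lerN2 => /(_ xy nyx).
  by rewrite !opprK [- x + _]addrC [- spowR _ x + _]addrC.
have [->|xNy] := eqVneq x y; first by rewrite !subrr expr0n/= !mul0r !mulr0.
have y0 : 0 <= y.
  have : x < y by rewrite lt_neqAle xNy.
  by rewrite leNgt => xy'; apply/negP => y0; move: nxy; rewrite !ltr0_norm; lra.
rewrite (max_idPr nxy) (ger0_norm y0) (ge0_spowR q0 y0).
have c1 : Num.min 1 q <= 1 by rewrite ge_min lexx.
have c0 : 0 < Num.min 1 q by rewrite lt_min ltr01.
have d1 : 1 <= Num.max 1 q by rewrite le_max lexx.
have Z0 := powR_ge0 y (q - 1).
have E (c d z : R) : c * (d ^+ 2 * z) = d * (c * (d * z)) by ring.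
rewrite !E; move: nxy; rewrite (ger0_norm y0); have [x0 _|x0 nxy] := ger0P x.
  rewrite (ge0_spowR q0 x0).
  have [lo up] := powR_increment_bounds q0 x0 xy.
  have W0 : 0 <= (y - x) * y `^ (q - 1) by rewrite mulr_ge0// subr_ge0.
  have yx0 : 0 <= y - x by rewrite subr_ge0.
  by split; rewrite ler_wpM2l//; nra.
rewrite -(opprK x) spowRN ge0_spowR ?oppr_ge0 ?(ltW x0)// !opprK.
have X0 := powR_ge0 (- x) q.
have : (- x) `^ q <= y `^ q by rewrite ge0_ler_powR// ?nnegrE//; lra.
rewrite -(mulr_powRB1 y0 q0) => XY.
have yx0 : 0 <= y + - x by lra.
split; rewrite ler_wpM2l//.
  apply: (@le_trans _ _ (y * y `^ (q - 1))); last lra.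
  by rewrite mulrA ler_wpM2r//; nra.
apply: (@le_trans _ _ (2 * (y * y `^ (q - 1)))); first lra.
by rewrite !mulrA ler_wpM2r//; nra.
Qed.

(** The exponent may have either sign: [x <= A * y] serves for [e >= 0] and [y <= A * x] for
    [e < 0]. *)
Lemma powR_comparable A e x y : 1 <= A -> 0 <= x -> 0 <= y ->
  x <= A * y -> y <= A * x -> x `^ e <= A `^ `|e| * y `^ e.
Proof.
move=> A1 x0 y0 xy yx; have A0 : 0 <= A by lra.
have A1e : 1 <= A `^ `|e| by have := ler_powR A1 (normr_ge0 e); rewrite powRr0.
have [e0|e0] := leP 0 e.
  by rewrite (ger0_norm e0) -powRM// ge0_ler_powR// ?nnegrE// mulr_ge0.
move: x0 yx xy; rewrite le_eqVlt => /predU1P[<-|x0] yx xy.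
  have -> : y = 0 by lra.
  by rewrite ler_peMl ?powR_ge0.
have yp : 0 < y by nra.
move: e0; rewrite -(opprK e); move: (- e) => f; rewrite oppr_lt0 => f0.
rewrite normrN (gtr0_norm f0) !powRN -(ler_pM2r (powR_gt0 f x0)).
rewrite mulVf ?gt_eqF ?powR_gt0//.
rewrite mulrAC ler_pdivlMr ?powR_gt0// mul1r -powRM// ?(ltW x0)//.
by rewrite ge0_ler_powR// ?nnegrE ?mulr_ge0 ?(ltW x0, ltW f0).
Qed.

Lemma spowR_increment_comparable q A : 0 < q -> 1 <= A ->
  exists2 C, 0 < C & forall x y u v : R,
    `|y - x| <= A * `|v - u| ->
    Num.max `|x| `|y| <= A * Num.max `|u| `|v| ->
    Num.max `|u| `|v| <= A * Num.max `|x| `|y| ->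
    (y - x) * (spowR q y - spowR q x) <= C * ((v - u) * (spowR q v - spowR q u)).
Proof.
move=> q0 A1.
have c0 : 0 < Num.min 1 q / 2 by rewrite divr_gt0// lt_min ltr01.
have d0 : 0 < 1 + Num.max 1 q by rewrite ltr_pwDl// le_max ler01.
have A0 : 0 < A by lra.
pose P := A `^ `|q - 1|.
exists ((1 + Num.max 1 q) * (A ^+ 2 * P) / (Num.min 1 q / 2)).
  by rewrite divr_gt0// mulr_gt0// mulr_gt0// ?exprn_gt0// powR_gt0.
move=> x y u v dxy m1 m2.
have [_ up] := spowR_increment_bounds x y q0.
have [lo _] := spowR_increment_bounds u v q0.
have E (d M c B : R) : d * M / c * B = d * (M * (B / c)) by ring.
apply: (le_trans up); rewrite E ler_pM2l//.
apply: (@le_trans _ _ (A ^+ 2 * P * ((v - u) ^+ 2 * Num.max `|u| `|v| `^ (q - 1)))).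
  rewrite mulrACA ler_pM ?sqr_ge0 ?powR_ge0//.
    rewrite -(real_normK (num_real (y - x))) -(real_normK (num_real (v - u))).
    by rewrite -exprMn lerXn2r// ?nnegrE// mulr_ge0// ltW.
  by apply: powR_comparable => //; rewrite le_max normr_ge0.
by rewrite ler_pM2l ?mulr_gt0 ?exprn_gt0 ?powR_gt0// ler_pdivlMr// mulrC.
Qed.

(** * The Bregman divergence in one variable *)

Definition bregman p a b : R := `|a + b| `^ p - `|a| `^ p - p * spowR (p - 1) a * b.

Lemma bregman_ge0 p a b : 1 < p -> 0 <= bregman p a b.
Proof.
move=> p1; have p0 : 0 < p by lra.
have := young_powR p1 (normr_ge0 (a + b)) (normr_ge0 a).
have : spowR (p - 1) a * (a + b) <= `|a + b| * `|a| `^ (p - 1).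
  apply: le_trans (ler_norm _) _; rewrite normrM mulrC ler_wpM2l//.
  rewrite /spowR normrM (ger0_norm (powR_ge0 _ _)) normr_sg.
  by rewrite ler_piMl ?powR_ge0//; case: (a != 0).
have := mulr_spowRB1 a p0.
by rewrite /bregman => *; nra.
Qed.

(** The right side is the sum of [bregman p a b] and [bregman p (a + b) (- b)], and the latter is
    nonnegative. *)
Lemma bregman_le p a b : 1 < p ->
  bregman p a b <= p * (b * (spowR (p - 1) (a + b) - spowR (p - 1) a)).
Proof.
move=> p1; have := bregman_ge0 (a + b) (- b) p1.
by rewrite /bregman addrK => *; nra.
Qed.

(* Writing both sides with tangent lines of [`|x| `^ p] at the midpoint and the
   three-quarter point of the segment leaves only an increment of its derivative. *)
Lemma bregman_double_ge p a b : 1 < p ->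
  p * (b / 4 * (spowR (p - 1) (a + 3 / 4 * b) - spowR (p - 1) (a + b / 2)))
    <= bregman p a b - 2 * bregman p a (b / 2).
Proof.
move=> p1.
have := bregman_ge0 (a + 3 / 4 * b) (b / 4) p1.
have := bregman_ge0 (a + b / 2) (b / 4) p1.
have := bregman_ge0 (a + b / 2) (- (b / 2)) p1.
rewrite /bregman addrK.
have -> : a + b / 2 + b / 4 = a + 3 / 4 * b by field.
have -> : a + 3 / 4 * b + b / 4 = a + b by field.
by move=> *; nra.
Qed.

Lemma ler_norm_combination A B a b x y :
  - A <= a <= A -> - B <= b <= B ->
  `|a * x + b * y| <= (A + B) * Num.max `|x| `|y|.
Proof.
rewrite -!ler_norml => aA bB; apply: le_trans (ler_normD _ _) _.
by rewrite !normrM mulrDl lerD// ler_pM// le_max lexx ?orbT.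
Qed.

Lemma bregman_comparable p : 1 < p -> exists2 C, 0 < C & forall a b t : R,
  2^-1 <= `|t| <= 2 ->
  bregman p a b <= C * (bregman p a (t * b) - 2 * bregman p a (t * b / 2)).
Proof.
move=> p1; have p0 : 0 < p by lra.
have q0 : 0 < p - 1 by lra.
(* The constant 21 bounds all the ratios below. The worst is
   [a + b = (3 - 4/t) * u + (4/t - 2) * v], whose coefficients are at most 11 and 10 in absolute
   value because [|1/t| <= 2]. *)
have [C C0 H] := @spowR_increment_comparable (p - 1) 21 q0 ltac:(lra).
exists C => // a b t /andP[t1 t2].
have tN0 : t != 0 by rewrite -normr_gt0; lra.
have s2 : `|t^-1| <= 2 by rewrite normfV -(invrK 2) lef_pV2 ?posrE; lra.
apply: le_trans (bregman_le _ _ p1) _.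
have := bregman_double_ge a (t * b) p1; rewrite -(ler_pM2l C0); apply: le_trans.
rewrite [leRHS]mulrCA ler_pM2l//.
have := H a (a + b) (a + t * b / 2) (a + 3 / 4 * (t * b)).
have -> : a + b - a = b by ring.
have -> : a + 3 / 4 * (t * b) - (a + t * b / 2) = t * b / 4 by field.
set u := a + t * b / 2; set v := a + 3 / 4 * (t * b).
have ea : a = 3 * u + (- 2) * v by rewrite /u /v; field.
have eb : a + b = (3 - 4 * t^-1) * u + (4 * t^-1 - 2) * v by rewrite /u /v; field.
have eu : u = (1 - t / 2) * a + t / 2 * (a + b) by rewrite /u; field.
have ev : v = (1 - 3 / 4 * t) * a + 3 / 4 * t * (a + b) by rewrite /v; field.
have A21 : 21 = 11 + 10 :> R by ring.
have /andP[s3 s4] : -2 <= t^-1 <= 2 by rewrite -ler_norml.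
have /andP[t3 t4] : -2 <= t <= 2 by rewrite -ler_norml.
apply.
- have := ler_wpM2r (normr_ge0 b) t1; have := normr_ge0 b.
  by rewrite !normrM normfV normr_nat; lra.
- rewrite ge_max {1}ea {1}eb A21.
  by apply/andP; split; apply: ler_norm_combination; lra.
- rewrite ge_max {1}eu {1}ev A21.
  by apply/andP; split; apply: ler_norm_combination; lra.
Qed.

(** According to whether [|b| <= e * |a|] or not, one of the two terms suffices alone. The gain is a
    coefficient of [|a|^p] as close to 1 as desired. *)
Lemma normD_powR_le p (e : R) a b : 0 < p -> 0 < e ->
  `|a + b| `^ p <= (1 + e) `^ p * `|a| `^ p + (1 + e^-1) `^ p * `|b| `^ p.
Proof.
move=> p0 e0; have e0' : 0 < e^-1 by rewrite invr_gt0.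
have ab := ler_normD a b.
rewrite -!powRM ?addr_ge0 ?ler01 ?(ltW e0) ?(ltW e0')//.
have [ba|ba] := leP `|b| (e * `|a|).
  apply: (@le_trans _ _ (((1 + e) * `|a|) `^ p)); last by rewrite lerDl powR_ge0.
  apply: (ge0_ler_powR (ltW p0)); rewrite ?nnegrE ?mulr_ge0 ?addr_ge0 ?(ltW e0)//.
  by rewrite mulrDl mul1r; exact: le_trans ab (lerD (lexx _) ba).
apply: (@le_trans _ _ (((1 + e^-1) * `|b|) `^ p)); last by rewrite lerDr powR_ge0.
apply: (ge0_ler_powR (ltW p0)); rewrite ?nnegrE ?mulr_ge0 ?addr_ge0 ?(ltW e0')//.
by apply: le_trans ab _; rewrite mulrDl mul1r addrC lerD2l mulrC ler_pdivlMr// mulrC ltW.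
Qed.

(** The tangent to [s^p] at [x] bounds [y - x] above, the one at [z] bounds [z - x] below. Their
    slopes differ by a factor at most [M], since [x * z^(p-1) <= z^p <= M * x^p]. *)
Lemma powR_increment_le p (C M : R) x y z : 1 < p -> 0 <= C ->
  0 < x -> 0 <= y -> 0 <= z ->
  x `^ p <= z `^ p -> z `^ p <= M * x `^ p ->
  y `^ p - x `^ p <= C * (z `^ p - x `^ p) ->
  y - x <= C * M * (z - x).
Proof.
move=> p1 C0 x0 y0 z0 xz zM yz; have p0 : 0 < p by lra.
have tang (s t : R) : 0 <= s -> 0 <= t ->
    p * (t `^ (p - 1) * (s - t)) <= s `^ p - t `^ p.
  move=> s0 t0; have := young_powR p1 s0 t0; rewrite -(mulr_powRB1 t0 p0).
  by move=> ?; nra.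
have lexz : x <= z.
  rewrite leNgt; apply/negP => zx.
  by have := gt0_ltr_powR p0 z0 (ltW x0) zx; rewrite ltNge xz.
have Hy := tang _ _ y0 (ltW x0); have Hz := tang _ _ (ltW x0) z0.
have ZX : z `^ (p - 1) <= M * x `^ (p - 1).
  rewrite -(ler_pM2l x0); apply: (@le_trans _ _ (z * z `^ (p - 1))).
    by rewrite ler_wpM2r ?powR_ge0.
  by rewrite [leRHS]mulrCA !mulr_powRB1// ltW.
have pX : 0 < p * x `^ (p - 1) by rewrite mulr_gt0// powR_gt0.
rewrite -(ler_pM2l pX).
apply: (@le_trans _ _ (C * (z `^ p - x `^ p))); first by clear -Hy yz; lra.
rewrite (_ : _ * (C * M * _) = C * (p * (M * x `^ (p - 1) * (z - x)))); last by ring.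
rewrite ler_wpM2l//.
have : p * (z `^ (p - 1) * (z - x)) <= p * (M * x `^ (p - 1) * (z - x)).
  by rewrite ler_pM2l// ler_wpM2r// subr_ge0.
by clear -Hz; lra.
Qed.

End RealPowers.

(** * The [p]-norm and the sum of [p]-th powers *)

Section PNorm.
Context {R : realType} {n : nat}.
Implicit Types (p C M : R) (x y z : 'rV[R]_n).

Definition psum p x : R := \sum_(i < n) `|x ord0 i| `^ p.

Lemma psum_ge0 p x : 0 <= psum p x.
Proof. by apply: sumr_ge0 => i _; exact: powR_ge0. Qed.

Lemma psum_gt0 p x : x != 0 -> 0 < psum p x.
Proof.
move=> xN0; have [i xi] : exists i, x ord0 i != 0.
  apply/existsP; apply: contraNT xN0; rewrite negb_exists => /forallP x0.
  by apply/eqP/rowP => i; rewrite mxE; exact/eqP/negPn/x0.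
rewrite /psum (bigD1 i)//= ltr_pwDl ?powR_gt0 ?normr_gt0//.
by apply: sumr_ge0 => j _; exact: powR_ge0.
Qed.

Lemma pnorm_ge0 p x : 0 <= pnorm p x.
Proof. exact: powR_ge0. Qed.

Lemma pnorm_powR p x : 0 < p -> pnorm p x `^ p = psum p x.
Proof.
by move=> p0; rewrite /pnorm -powRrM mulVf ?gt_eqF// powRr1// psum_ge0.
Qed.

Lemma pnormZ p c x : 0 < p -> pnorm p (c *: x) = `|c| * pnorm p x.
Proof.
move=> p0; rewrite /pnorm; under eq_bigr do rewrite mxE normrM powRM//.
rewrite -mulr_sumr powRM ?powR_ge0 ?psum_ge0//.
by rewrite -powRrM mulfV ?gt_eqF// powRr1.
Qed.

Lemma psumD p x y : \sum_(i < n) spowR (p - 1) (x ord0 i) * y ord0 i = 0 ->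
  psum p (x + y) = psum p x + \sum_(i < n) bregman p (x ord0 i) (y ord0 i).
Proof.
move=> xy.
have -> : psum p x = psum p x + p * \sum_(i < n) spowR (p - 1) (x ord0 i) * y ord0 i.
  by rewrite xy mulr0 addr0.
rewrite mulr_sumr /psum -!big_split/=.
by apply: eq_bigr => i _; rewrite mxE /bregman; ring.
Qed.

Lemma psumD_le p M : 1 < p -> 1 < M -> exists2 r, 0 < r & forall x y,
  pnorm p y <= r * pnorm p x -> psum p (x + y) <= M * psum p x.
Proof.
move=> p1 M1; have p0 : 0 < p by lra.
(* The excess [M - 1] is split into two halves [N - 1]: one is spent on [(1 + e)^p = N], the other
   on [(k * r)^p], the contribution of [y]. *)
have [N N1 NM] : exists2 N, 1 < N & M = 2 * N - 1.
  by exists ((1 + M) / 2); [lra|field].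
have [e e0 eN] : exists2 e, 0 < e & (1 + e) `^ p = N.
  exists (N `^ p^-1 - 1).
    by rewrite subr_gt0 -[ltLHS](powRr0 N) /powR gt_eqF ?ltr_expR ?mul0r
      ?mulr_gt0 ?invr_gt0 ?ln_gt0//; lra.
  by rewrite addrC subrK -powRrM mulVf ?gt_eqF// powRr1//; lra.
pose k := 1 + e^-1; have k0 : 0 < k by rewrite addr_gt0 ?invr_gt0.
have [r r0 rM] : exists2 r, 0 < r & (k * r) `^ p = N - 1.
  exists ((N - 1) `^ p^-1 / k); first by rewrite divr_gt0// powR_gt0; lra.
  by rewrite mulrC divfK ?gt_eqF// -powRrM mulVf ?gt_eqF// powRr1; lra.
exists r => // x y yx.
have : psum p (x + y) <= N * psum p x + k `^ p * psum p y.
  rewrite /psum !mulr_sumr -big_split/=.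
  by apply: ler_sum => i _; rewrite mxE -eN; exact: normD_powR_le.
rewrite NM; move/le_trans; apply; move: yx.
rewrite -(pnorm_powR x p0) -(pnorm_powR y p0).
move: (pnorm_ge0 p x) (pnorm_ge0 p y).
move: (pnorm p x) (pnorm p y) => {x y} X Y X0 Y0 YX.
have : k `^ p * Y `^ p <= (N - 1) * X `^ p.
  rewrite -rM -!powRM// ?mulr_ge0 ?(ltW k0) ?(ltW r0)//.
  apply: (ge0_ler_powR (ltW p0)); rewrite ?nnegrE ?mulr_ge0 ?(ltW k0) ?(ltW r0)//.
  by rewrite -mulrA ler_pM2l.
by clear; lra.
Qed.

Lemma pnorm_increment_le p C M x y z : 1 < p -> 0 <= C -> x != 0 ->
  psum p x <= psum p z -> psum p z <= M * psum p x ->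
  psum p y - psum p x <= C * (psum p z - psum p x) ->
  pnorm p y - pnorm p x <= C * M * (pnorm p z - pnorm p x).
Proof.
move=> p1 C0 xN0; have p0 : 0 < p := lt_trans ltr01 p1.
rewrite -(pnorm_powR x p0) -(pnorm_powR y p0) -(pnorm_powR z p0).
by apply: powR_increment_le => //; rewrite ?powR_ge0// powR_gt0// psum_gt0.
Qed.

End PNorm.

(** * The gradient of the [p]-norm *)

Section Gradient.
Context {R : realType}.
Local Open Scope classical_set_scope.

Lemma is_derive1_norm_powR (p a : R) : 1 < p ->
  is_derive a 1 (fun z => `|z| `^ p) (p * spowR (p - 1) a).
Proof.
move=> p1; have p0 : 0 < p by lra.
have q0 : 0 < p - 1 by lra.
have [a0|a0|->] := ltgtP a 0.
- have H : {near a, (fun z : R => (- z) `^ p) =1 (fun z : R => `|z| `^ p)}.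
    near=> z; rewrite /= ltr0_norm//; near: z; exact: lt_nbhsl.
  apply: (near_eq_is_derive H).
  have Na0 : 0 < - a by rewrite oppr_gt0.
  have -> : p * spowR (p - 1) a = p * (- a) `^ (p - 1) * -1.
    by rewrite -{1}(opprK a) spowRN ge0_spowR ?(ltW Na0)// mulrN mulrN1.
  exact: (is_derive1_comp (is_derive1_powR p Na0) (is_deriveNid a 1)).
- have H : {near a, (fun z : R => z `^ p) =1 (fun z : R => `|z| `^ p)}.
    near=> z; rewrite gtr0_norm//; near: z; exact: lt_nbhsr.
  by apply: (near_eq_is_derive H); rewrite ge0_spowR ?(ltW a0)//; exact: is_derive1_powR.
(* At 0 the difference quotient has absolute value [|h|^(p-1)], which is below [e] as soon as
   [|h| < e^(1/(p-1))]. *)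
- have H : (fun h : R => h^-1 *: ((((fun z : R => `|z| `^ p) \o shift 0) (h *: 1)) -
      `|0 : R| `^ p)) @ 0^' --> (0 : R).
    apply/cvgrPdist_lt => e e0; near=> h.
    have hN0 : h != 0 by near: h; exact: nbhs_dnbhs_neq.
    rewrite /= addr0 normr0 powR0 ?gt_eqF// subr0 sub0r normrN.
    rewrite /GRing.scale/= mulr1 normrM normfV (ger0_norm (powR_ge0 _ _)).
    rewrite -(mulr_powRB1 (normr_ge0 h) p0) mulKf ?normr_eq0//.
    have -> : e = (e `^ (p - 1)^-1) `^ (p - 1).
      by rewrite -powRrM mulVf ?gt_eqF// powRr1// ltW.
    rewrite gt0_ltr_powR// ?nnegrE ?powR_ge0//.
    near: h; apply: dnbhs0_lt; exact: powR_gt0.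
  rewrite ge0_spowR// powR0 ?gt_eqF// mulr0.
  apply: DeriveDef; first by apply/cvg_ex; exists 0.
  exact: cvg_lim H.
Unshelve. all: by end_near.
Qed.

Lemma derive_line (V : normedModType R) (f : V -> R) (x v : V) :
  'D_v f x = 'D_1 (fun h : R => f (h *: v + x)) 0.
Proof.
rewrite /derive.
have -> // : (fun h : R => h^-1 *: ((f \o shift x) (h *: v) - f x)) =
    (fun h : R => h^-1 *: (((fun h' : R => f (h' *: v + x)) \o shift 0) (h *: 1)
      - f (0 *: v + x))).
by apply/funext => h /=; rewrite addr0 scale0r add0r [h%:A]mulr1.
Qed.

Lemma grad_pnorm (n : nat) (p : R) (x : 'rV[R]_n) i : 1 < p -> x != 0 ->
  grad (pnorm p) x ord0 i = psum p x `^ (p^-1 - 1) * spowR (p - 1) (x ord0 i).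
Proof.
move=> p1 xN0; have p0 : 0 < p by lra.
rewrite mxE derive_line.
(* Along the [i]-th axis only one summand moves, so the sum is the constant [c] plus a translate of
   [|z|^p], and the one-variable chain rule applies. *)
pose c := psum p x - `|x ord0 i| `^ p.
pose F (z : R) : R := `|z| `^ p; pose G : R -> R := cst c + F \o shift (x ord0 i).
have GE h : G h = psum p (h *: delta_mx ord0 i + x).
  rewrite -[LHS]/(c + `|h + x ord0 i| `^ p) /c /psum !(bigD1 (P := predT) i)//=.
  have E (u v w : R) : u + v - u + w = w + v by ring.
  rewrite {}E; congr (_ + _).
    by rewrite !mxE !eqxx mulr1.
  by apply: eq_bigr => j ji; rewrite !mxE eqxx (negPf ji) mulr0 add0r.
have -> : (fun h : R => pnorm p (h *: delta_mx ord0 i + x)) =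
    (fun s : R => s `^ p^-1) \o G.
  by apply/funext => h /=; rewrite GE.
have dG : is_derive (0 : R) 1 G (0 + p * spowR (p - 1) (x ord0 i) * 1).
  apply: is_deriveD; first exact: is_derive_cst.
  have dF : is_derive (shift (x ord0 i) 0) 1 F (p * spowR (p - 1) (x ord0 i)).
    by rewrite /= add0r; exact: is_derive1_norm_powR.
  exact: (is_derive1_comp dF (is_derive_shift _ _ _)).
have G0 : 0 < G 0 by rewrite GE scale0r add0r psum_gt0.
have [_ ->] := is_derive1_comp (is_derive1_powR p^-1 G0) dG.
by rewrite GE scale0r add0r; field; rewrite gt_eqF.
Qed.

End Gradient.

(** * Transfer from coordinates to the tangent plane *)

Section Tangent.
Context {R : realType} {n : nat}.
Implicit Types (p C M : R) (x y : 'rV[R]_n).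

Lemma inner_grad_pnorm p x y : 1 < p -> x != 0 ->
  inner y (grad (pnorm p) x) =
  psum p x `^ (p^-1 - 1) * \sum_(i < n) spowR (p - 1) (x ord0 i) * y ord0 i.
Proof.
move=> p1 xN0; rewrite /inner mulr_sumr; apply: eq_bigr => i _.
by rewrite grad_pnorm//; ring.
Qed.

(** Euler's identity for a function homogeneous of degree 1: the inner product of [x] with the
    gradient at [x] is the norm of [x]. *)
Lemma hfun_pnormD p x y : 1 < p -> x != 0 -> inner y (grad (pnorm p) x) = 0 ->
  hfun (pnorm p) x (x + y) = pnorm p (x + y) - pnorm p x.
Proof.
move=> p1 xN0 xy; have p0 : 0 < p by lra.
rewrite /hfun; congr (_ - _).
have -> : inner (x + y) (grad (pnorm p) x) =
    inner x (grad (pnorm p) x) + inner y (grad (pnorm p) x).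
  by rewrite /inner -big_split/=; apply: eq_bigr => i _; rewrite mxE mulrDl.
rewrite xy addr0 inner_grad_pnorm//.
under eq_bigr do rewrite mulrC mulr_spowRB1//.
by rewrite mulrC mulr_powRB1 ?invr_gt0// psum_ge0.
Qed.

Lemma innerZl c x y : inner (c *: x) y = c * inner x y.
Proof. by rewrite /inner mulr_sumr; apply: eq_bigr => i _; rewrite mxE mulrA. Qed.

Lemma hfun_pnorm_le p s t C M : 1 < p -> 0 <= C -> 1 < M ->
  (forall a b, bregman p a (s * b) <= C * bregman p a (t * b)) ->
  exists2 r, 0 < r & forall x y, x != 0 -> pnorm p y <= r * pnorm p x ->
    inner y (grad (pnorm p) x) = 0 ->
    hfun (pnorm p) x (x + s *: y) <= C * M * hfun (pnorm p) x (x + t *: y).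
Proof.
move=> p1 C0 M1 st; have p0 : 0 < p by lra.
have [r r0 rM] := @psumD_le R n p M p1 M1.
have t0 : 0 < 1 + `|t| by rewrite ltr_pwDl.
(* This radius keeps [t *: y] within [r]; the added 1 covers [t = 0]. *)
exists (r / (1 + `|t|)); first exact: divr_gt0.
move=> x y xN0 yx xy.
have sx := psum_gt0 p xN0.
have orth c : \sum_(i < n) spowR (p - 1) (x ord0 i) * (c *: y) ord0 i = 0.
  apply/eqP; have := inner_grad_pnorm (c *: y) p1 xN0.
  rewrite innerZl xy mulr0 => /esym/eqP.
  by rewrite mulf_eq0 gt_eqF//= powR_gt0.
rewrite !hfun_pnormD// ?innerZl ?xy ?mulr0//.
apply: pnorm_increment_le => //.
- rewrite psumD// lerDl; apply: sumr_ge0 => i _; exact: bregman_ge0.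
- apply: rM; move: yx (pnorm_ge0 p y); rewrite (pnormZ _ _ p0).
  move: (pnorm p x) (pnorm p y) => X Y; rewrite mulrAC ler_pdivlMr// mulrC => YX Y0.
  by apply: le_trans YX; rewrite ler_wpM2r// lerDr.
- rewrite !psumD// ![psum p x + _]addrC !addrK mulr_sumr.
  by apply: ler_sum => i _; rewrite !mxE.
Qed.

End Tangent.

Theorem theorem6p7 (R : realType) (n : nat) (p : R) (hp : 1 < p) :
  geom_convex_tangent (@pnorm R n p) /\
  doubling_tangent (@pnorm R n p) /\
  balanced_tangent (@pnorm R n p).
Proof.
have [C C0 HC] := bregman_comparable hp.
have weak t a b : 2^-1 <= `|t| <= 2 -> bregman p a b <= C * bregman p a (t * b).
  move=> /HC/le_trans; apply; rewrite ler_pM2l// gerDl.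
  by rewrite oppr_le0 mulr_ge0// bregman_ge0.
have C2 : 0 < C * 2 by rewrite mulr_gt0.
split; [|split].
(* With [t = 2], [HC] gives [(1 + 2C) * bregman p a b <= C * bregman p a (2b)]. The loss
   [M = 1 + 1/(4C)] turns [C / (1 + 2C)] into [(1 + 4C) / (4 + 8C)], still below 1/2; its inverse is
   the witness for [Lam]. *)
- have c0 : 0 < 1 + 2 * C by lra.
  have M1 : 1 < 1 + (4 * C)^-1 by rewrite ltrDl invr_gt0; lra.
  have [|r r0 H] := @hfun_pnorm_le R n p 1 2 (C / (1 + 2 * C)) _ hp
    (ltW (divr_gt0 C0 c0)) M1.
    move=> a b; rewrite mul1r mulrAC ler_pdivlMr//.
    have := HC a b 2; rewrite ger0_norm// (mulrC 2) mulfK//.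
    by move=> /(_ ltac:(lra)); lra.
  exists ((4 + 8 * C) / (1 + 4 * C)), r; split; last split => //.
    by rewrite ltr_pdivlMr; lra.
  move=> x y xN0 yx xy; have := H x y xN0 yx xy; rewrite scale1r.
  move: (hfun _ _ (x + y)) (hfun _ _ (x + 2 *: y)) => u v.
  have -> : C / (1 + 2 * C) * (1 + (4 * C)^-1) = (1 + 4 * C) / (4 + 8 * C).
    by field; clear -C0; lra.
  rewrite [X in _ <= X -> _]mulrAC ler_pdivlMr; last by clear -C0; lra.
  rewrite [X in _ -> X <= _]mulrAC ler_pdivrMr; last by clear -C0; lra.
  by rewrite mulrC [v * _]mulrC.
(* Any finite constant will do for doubling and balance, so [M = 2] is taken; here [weak] is used at
   [t = 1/2] with increment [2 * b]. *)
- have [|r r0 H] := @hfun_pnorm_le R n p 2 1 C 2 hp (ltW C0) ltac:(lra).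
    move=> a b; have := weak 2^-1 a (2 * b).
    by rewrite mulKf ?mul1r// ger0_norm// ?invr_ge0//; apply; lra.
  exists (C * 2), r; split=> //; split=> // x y xN0 yx xy.
  by have := H x y xN0 yx xy; rewrite scale1r.
- have [|r r0 H] := @hfun_pnorm_le R n p 1 (-1) C 2 hp (ltW C0) ltac:(lra).
    by move=> a b; rewrite mul1r; apply: weak; rewrite normrN1; lra.
  exists r, (C * 2); split=> //; split=> // x y xN0 yx xy.
  by have := H x y xN0 yx xy; rewrite scale1r scaleN1r.
Qed.
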